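(* Let $n\ge 1$, let $F_n$ be the set of rooted forests on the vertex set $\{1,\dots,n\}$ and $PF_n$ the set of parking functions of length $n$. There is a (nonrecursive) bijection $\varphi:F_n\to PF_n$ such that for every $F\in F_n$, $$(\operatorname{tinv}(F),\operatorname{tree}(F))=(\operatorname{tjump}(\varphi(F)),\operatorname{critic}(\varphi(F))).$$
   Context: A rooted forest on $\{1,\dots,n\}$ is a graph on the labeled vertex set $\{1,\dots,n\}$ each of whose connected components is a tree with one distinguished vertex (its root). A vertex $j$ is a descendant of $i$ if $j\neq i$ and $i$ lies on the unique path from the root of its component to $j$. For a vertex $v$, $\operatorname{inv}(F:v)$ is the number of descendants $x$ of $v$ with $x<v$. For $0\le i\le n$, $\operatorname{lead}_i(F)$ is the number of vertices $v$ with $\operatorname{inv}(F:v)=i$, and $\operatorname{tinv}(F)=(\operatorname{lead}_0(F),\dots,\operatorname{lead}_n(F))$. $\operatorname{tree}(F)$ is the number of connected components (trees) of $F$. Parking algorithm: given a sequence $(p_1,\dots,p_n)$ of positive integers, cars $1,2,\dots,n$ arrive in that order at a one-way street with spaces $1,2,3,\dots$; car $c$ goes to space $p_c$ and parks in the first empty space among $p_c,p_c+1,\dots$; let $q_c$ be the space where car $c$ parks. The sequence is a parking function of length $n$ if $q_c\le n$ for all $c$. For a parking function $P$, $\operatorname{jump}(P:c)=q_c-p_c$; for $0\le i\le n$, $\operatorname{lucky}_i(P)$ is the number of cars $c$ with $\operatorname{jump}(P:c)=i$, and $\operatorname{tjump}(P)=(\operatorname{lucky}_0(P),\dots,\operatorname{lucky}_n(P))$.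 A car $c$ is critical if, at the moment it parks, all spaces $q_c+1,\dots,n$ are already occupied (equivalently, every car parked in a space to the right of $q_c$ has a smaller number than $c$); $\operatorname{critic}(P)$ is the number of critical cars. *)

(* Defs.v *)
From mathcomp Require Import all_boot.
Set Implicit Arguments. Unset Strict Implicit. Unset Printing Implicit Defensive.

(* ---------- Rooted forests on {1,...,n} ----------
   Vertex k+1 of the paper is represented by (k : 'I_n); this shift preserves
   the order <, so all statistics are unchanged.
   A rooted forest is encoded by its parent map: parent v = None iff v is a
   root, otherwise parent v = Some u where u is the neighbour of v on the path
   from v to the root of its tree. The map must be acyclic: following parents
   from any vertex reaches a root (this always happens within n steps). *)

Definition pstep n (p : {ffun 'I_n -> option 'I_n}) (o : option 'I_n) :
  option 'I_n := obind p o.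

Definition is_forest n (p : {ffun 'I_n -> option 'I_n}) : bool :=
  [forall v : 'I_n, iter n.+1 (pstep p) (Some v) == None].

Definition forest n := {p : {ffun 'I_n -> option 'I_n} | is_forest p}.

(* j is a descendant of i: j <> i and i lies on the path from the root to j,
   i.e. i = parent^(k+1)(j) for some k (depths are < n). *)
Definition descendant n (F : forest n) (i j : 'I_n) : bool :=
  (j != i) && [exists k : 'I_n, iter k.+1 (pstep (val F)) (Some j) == Some i].

Definition inv n (F : forest n) (v : 'I_n) : nat :=
  #|[set x : 'I_n | descendant F v x & (x < v)%N]|.

Definition lead n (F : forest n) (i : nat) : nat :=
  #|[set v : 'I_n | inv F v == i]|.

Definition tinv n (F : forest n) : seq nat := mkseq (lead F) n.+1.

Definition tree n (F : forest n) : nat := #|[set v : 'I_n | val F v == None]|.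

(* ---------- Parking functions ----------
   A preference sequence is s = [:: p_1; ...; p_m] (car c+1 is at index c). *)

(* first space >= a not in occ (fuel = size occ + 1 suffices) *)
Fixpoint first_free (fuel : nat) (occ : seq nat) (a : nat) : nat :=
  if fuel is f.+1 then (if a \in occ then first_free f occ a.+1 else a) else a.

Definition park_step (occ : seq nat) (a : nat) : seq nat :=
  rcons occ (first_free (size occ).+1 occ a).

Definition spots (s : seq nat) : seq nat := foldl park_step [::] s.

Definition is_parking_function (n : nat) (s : seq nat) : bool :=
  [&& size s == n, all (fun a => 0 < a) s & all (fun q => q <= n) (spots s)].

Definition parking_function n := {s : seq nat | is_parking_function n s}.

Definition jump (s : seq nat) (c : nat) : nat := nth 0 (spots s) c - nth 0 s c.

Definition lucky n (P : parking_function n) (i : nat) : nat :=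
  count (fun c => jump (val P) c == i) (iota 0 n).

Definition tjump n (P : parking_function n) : seq nat := mkseq (lucky P) n.+1.

Definition critical n (s : seq nat) (c : nat) : bool :=
  let q := nth 0 (spots s) c in
  all (fun t => t \in take c (spots s)) (iota q.+1 (n - q)).

Definition critic n (P : parking_function n) : nat :=
  count (critical n (val P)) (iota 0 n).

(* Main.v *)
Require Import Defs.
From mathcomp Require Import all_boot all_fingroup zify.
Set Implicit Arguments. Unset Strict Implicit. Unset Printing Implicit Defensive.

(** Both sides are put in bijection with pairs (p, j), where p is a parent map
    with p(v) > v for every non-root v, and j(v) is at most the number of
    descendants of v.

    Forests: for c = n-1, ..., 0, let r be the topmost vertex with label at
    most c among c and its ancestors, and let S be the vertex set of the subtree
    at r.  Then c = max S.  Record j(c) := inv(r), relabel r as c and map S \ r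
    to S \ c by the increasing bijection.  All other inversion numbers are
    unchanged, and r is recovered from S and j(c).

    Parking functions: the parking order is a permutation, encoded by the map p
    sending a car to the nearest larger car on its right.  The car is critical
    iff p is undefined there, and its descendants are the cars of the maximal
    block of smaller cars ending just before it, so that the possible jumps are
    exactly 0, ..., #descendants. *)

(** * Decreasing relabelling of forests *)

Section ForestMaps.
Variable n : nat.
Implicit Types (p : {ffun 'I_n -> option 'I_n}) (i j v c r : 'I_n) (S : {set 'I_n}).

(** * Ancestry in a forest given by its parent map *)

Lemma iter_pstep_None p k : iter k (pstep p) None = None.
Proof. by elim: k => //= k ->. Qed.

(** Induction from the roots downwards; the number of parent steps needed to reach [None] serves as
    the measure. *)
Lemma forest_ind p (P : 'I_n -> Prop) : is_forest p ->
  (forall v, (forall u, p v = Some u -> P u) -> P v) -> forall v, P v.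
Proof.
move=> /forallP pF IH v; move/eqP: (pF v); elim: (n.+1) v => // k IHk v.
rewrite iterSr /= => Hk; apply: IH => u pv; apply: IHk.
by rewrite -[RHS]Hk pv.
Qed.

(** [descendant] without the clause [j != i], which acyclicity restores through [desc_irr]. *)
Definition desc p i j : bool :=
  [exists k : 'I_n, iter k.+1 (pstep p) (Some j) == Some i].

Lemma descP p i j : is_forest p ->
  reflect (exists k, iter k.+1 (pstep p) (Some j) = Some i) (desc p i j).
Proof.
move=> /forallP pF; apply: (iffP existsP) => [[k /eqP Hk]|[k Hk]]; first by exists k.
suff lt_kn : k < n by exists (Ordinal lt_kn); apply/eqP.
rewrite ltnNge; apply/negP => le_nk.
have := Hk; rewrite -(subnK le_nk) -addnS iterD.
by rewrite (eqP (pF j)) iter_pstep_None.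
Qed.

Lemma descE p i j : is_forest p ->
  desc p i j = if p j is Some u then (u == i) || desc p i u else false.
Proof.
move=> pF; apply/(descP _ _ pF)/idP => [[[|k]]|].
- by rewrite /=; case: (p j) => //= u [->]; rewrite eqxx.
- rewrite iterSr /=; case: (p j) => [u|] /= Hk.
    by apply/orP; right; apply/(descP _ _ pF); exists k.
  by rewrite iter_pstep_None in Hk.
case pj: (p j) => [u|] // /orP[/eqP<-|/(descP _ _ pF)[k Hk]].
  by exists 0; rewrite /= pj.
by exists k.+1; rewrite iterSr /= pj.
Qed.

Lemma desc_trans p i j v : is_forest p -> desc p i j -> desc p j v -> desc p i v.
Proof.
move=> pF ij; move: v; apply: (forest_ind pF) => v /= IH.
rewrite (descE j) // (descE i v) //; case pv: (p v) => [u|] //.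
case/orP=> [/eqP->|/(IH _ pv)->]; by rewrite ?ij orbT.
Qed.

Lemma desc_irr p v : is_forest p -> desc p v v = false.
Proof.
move=> pF; suff /(_ v) : forall v, ~ desc p v v by case: (desc p v v) => // /(_ isT).
move=> {v}; apply: (forest_ind pF) => v IH vv.
move: (vv); rewrite descE //; case pv: (p v) => [u|] // /orP[/eqP uv|vu].
  by apply: (IH v); rewrite // pv uv.
apply: (IH _ pv); apply: (desc_trans pF _ vu).
by rewrite descE // pv eqxx.
Qed.

(** The ancestors of a vertex form a chain. *)
Lemma desc_comparable p i j v : is_forest p -> desc p i v -> desc p j v ->
  [|| i == j, desc p i j | desc p j i].
Proof.
move=> pF; move: v; apply: (forest_ind pF) => v /= IH.
rewrite (descE i v) // (descE j v) //; case pv: (p v) => [u|] //.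
case/orP=> [/eqP<-|iu] /orP[/eqP<-|ju]; rewrite ?eqxx ?iu ?ju ?orbT //.
exact: IH pv iu ju.
Qed.

(** * Relabelling a forest by a permutation *)

Definition relabel (t : {perm 'I_n}) p : {ffun 'I_n -> option 'I_n} :=
  [ffun v => omap t (p (t^-1 v)%g)].

Lemma relabelE t p v : relabel t p (t v) = omap t (p v).
Proof. by rewrite ffunE permK. Qed.

Lemma relabelK t : cancel (relabel t) (relabel t^-1).
Proof.
move=> p; apply/ffunP=> v; rewrite !ffunE invgK permK.
by case: (p v) => //= u; rewrite permK.
Qed.

Lemma relabelVK t : cancel (relabel t^-1) (relabel t).
Proof. by move=> p; rewrite -{1}(invgK t) relabelK. Qed.

Lemma iter_relabel t p k o :
  iter k (pstep (relabel t p)) (omap t o) = omap t (iter k (pstep p) o).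
Proof.
elim: k => //= k ->; case: (iter k _ o) => //= v; exact: relabelE.
Qed.

Lemma relabel_forest t p : is_forest p -> is_forest (relabel t p).
Proof.
move=> /forallP pF; apply/forallP => v.
by rewrite -(permKV t v) -[Some (t _)]/(omap t (Some _)) iter_relabel (eqP (pF _)).
Qed.

Lemma relabel_desc t p i j : desc (relabel t p) (t i) (t j) = desc p i j.
Proof.
apply: eq_existsb => k; rewrite -[Some (t j)]/(omap t (Some j)) iter_relabel.
by case: (iter _ _ _) => //= u; apply: (inj_eq perm_inj).
Qed.

Definition descs p v : {set 'I_n} := [set x | desc p v x].

Lemma relabel_descs t p v : descs (relabel t p) (t v) = t @: descs p v.
Proof.
apply/setP=> x; rewrite inE -(permKV t x) relabel_desc mem_imset ?inE //.
exact: perm_inj.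
Qed.

Definition subtree p v : {set 'I_n} := v |: descs p v.

Lemma relabel_subtree t p v : subtree (relabel t p) (t v) = t @: subtree p v.
Proof. by rewrite /subtree imsetU1 relabel_descs. Qed.

(** * Moving a label to the maximum of a set while keeping the order of the others *)

Lemma exists_rotation S r c : r \in S -> c \in S -> (forall x, x \in S -> x <= c) ->
  exists t : {perm 'I_n}, [/\ t r = c, forall x, x \notin S -> t x = x,
    forall x, x \in S -> t x \in S &
    forall x y, x \in S :\ r -> y \in S :\ r -> x < y -> t x < t y].
Proof.
(* Induction on the number of elements of [S] above [r]: swap [r] with its successor [s] in [S],
   then continue from [s]. *)
move: {2}_.+1 (ltnSn #|[set x in S | r < x]|) => m; elim: m r => // m IH r.
rewrite ltnS => le_m rS cS cmax.
have [<-|rc] := eqVneq r c.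
  by exists 1%g; split=> [|x _|x|x y _ _]; rewrite ?perm1.
have lt_rc : r < c by rewrite ltn_neqAle rc cmax.
have c_ok : (c \in S) && (r < c) by rewrite cS.
case: (@arg_minnP _ c (fun x => (x \in S) && (r < x)) val c_ok) => s /andP[sS rs] smin.
have [||//|//|t [ts tid tS tmon]] := IH s.
- apply: leq_trans le_m; apply: proper_card; apply/properP; split.
    by apply/subsetP=> x; rewrite !inE => /andP[-> /(ltn_trans rs)].
  by exists s; rewrite !inE sS ?ltnn ?rs.
- exact: sS.
exists (tperm r s * t)%g.
have sr : s != r by apply: contraTneq rs => ->; rewrite ltnn.
have tpS x : x \in S -> tperm r s x \in S.
  by case: tpermP => //.
split=> [|x xS|x xS|x y].
- by rewrite permM tpermL.
- by rewrite permM tpermD ?tid //; apply: contraNneq xS => <-.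
- by rewrite permM; apply/tS/tpS.
rewrite !inE => /andP[xr xS] /andP[yr yS] xy; rewrite !permM; apply: tmon.
- by rewrite !inE tpS // andbT; apply: contra xr => /eqP E; rewrite -(tpermK r s x) E tpermR.
- by rewrite !inE tpS // andbT; apply: contra yr => /eqP E; rewrite -(tpermK r s y) E tpermR.
case: (tpermP r s x) xr xy => [->|-> _|_ /eqP xns xr]; first by rewrite eqxx.
  case: (tpermP r s y) yr => [->|->|_ _ _]; rewrite ?eqxx ?ltnn //.
  exact: ltn_trans rs.
case: (tpermP r s y) yr => [->|->|//]; first by rewrite eqxx.
(* Here [y = s] is sent to [r]. As no element of [S] lies strictly between [r] and [s], [x < s]
   gives [x < r]. *)
move=> _ xs; rewrite ltn_neqAle (inj_eq val_inj) xr /=.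
by rewrite leqNgt; apply: contraTN xs => rx; rewrite -leqNgt; apply: smin; rewrite xS.
Qed.

Definition is_rotation S r c (t : {perm 'I_n}) : bool :=
  [&& t r == c, [forall x, (x \notin S) ==> (t x == x)],
   [forall x, (x \in S) ==> (t x \in S)] &
   [forall x in S :\ r, forall y in S :\ r, (x < y) ==> (t x < t y)]].

(** The choice depends only on [S], [r] and [c], so [step] and [unstep] use literally the same
    permutation once [unstep] has recovered [S] and [r]. *)
Definition rotation S r c : {perm 'I_n} := odflt 1%g [pick t | is_rotation S r c t].

Lemma rotationP S r c : r \in S -> c \in S -> (forall x, x \in S -> x <= c) ->
  let t := rotation S r c in
  [/\ t r = c, forall x, x \notin S -> t x = x, t @: S = S &
    forall x y, x \in S :\ r -> y \in S :\ r -> (t x < t y) = (x < y)].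
Proof.
move=> rS cS cmax; rewrite /= /rotation; case: pickP => [t|no_t] /=; last first.
  have [t [tr tid tS tmon]] := exists_rotation rS cS cmax.
  suff : is_rotation S r c t by rewrite no_t.
  apply/and4P; split; first exact/eqP.
  - by apply/forallP=> x; apply/implyP=> /tid/eqP.
  - by apply/forallP=> x; apply/implyP=> /tS.
  - apply/forall_inP=> x xS; apply/forall_inP=> y yS; apply/implyP; exact: tmon.
case/and4P=> /eqP tr /forallP tid /forallP tS /forall_inP tmon.
have mon x y : x \in S :\ r -> y \in S :\ r -> x < y -> t x < t y.
  by move=> xS yS; apply/implyP; apply: (forall_inP (tmon x xS)).
split=> // [x xS||x y xS yS].
- by apply/eqP; apply: implyP (tid x) xS.
- apply/eqP; rewrite eqEcard card_imset ?leqnn ?andbT; last exact: perm_inj.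
  by apply/subsetP=> _ /imsetP[x xS ->]; apply: implyP (tS x) xS.
apply/idP/idP; last exact: mon.
move=> txy; rewrite ltnNge leq_eqVlt; apply/norP; split.
  by apply: contraTneq txy => /val_inj->; rewrite ltnn.
by apply/negP => /(mon _ _ yS xS)/ltnW; rewrite leqNgt txy.
Qed.

(** * Ranks of elements in a set of labels *)

Lemma index_sorted_ltn (s : seq nat) x : sorted ltn s -> x \in s ->
  index x s = count (fun y => y < x) s.
Proof.
elim: s => //= a s IH pth; rewrite inE [a == x]eq_sym; have [->|xa] /= := eqVneq x a.
  move=> _; rewrite ltnn; apply/esym/eqP; rewrite eqn0Ngt -has_count.
  apply/hasPn=> y ys; rewrite -leqNgt ltnW //.
  exact: (allP (order_path_min ltn_trans pth)).
move=> xs; rewrite (allP (order_path_min ltn_trans pth) _ xs).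
by rewrite IH // (path_sorted pth).
Qed.

Definition rank S x := #|[set y in S | y < x]|.

Lemma index_enum_rank S x : x \in S -> index x (enum S) = rank S x.
Proof.
move=> xS; rewrite -(index_map val_inj) index_sorted_ltn.
- rewrite count_map /rank cardE {1}/enum_mem /enum_mem count_filter size_filter.
  by apply: eq_count => y; rewrite /= !inE andbC.
- apply: (subseq_sorted ltn_trans (s2 := map val (enum 'I_n))).
    by apply: map_subseq; rewrite /enum_mem filter_predT; apply: filter_subseq.
  by rewrite val_enum_ord iota_ltn_sorted.
by rewrite mem_map ?mem_enum //; apply: val_inj.
Qed.

Lemma nth_enum_rank S x0 x : x \in S -> nth x0 (enum S) (rank S x) = x.
Proof. by move=> xS; rewrite -index_enum_rank // nth_index ?mem_enum. Qed.

Lemma rank_nth_enum S x0 k : k < #|S| ->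
  nth x0 (enum S) k \in S /\ rank S (nth x0 (enum S) k) = k.
Proof.
rewrite cardE => lt_k; have rS : nth x0 (enum S) k \in S by rewrite -mem_enum mem_nth.
by rewrite -index_enum_rank // index_uniq ?enum_uniq.
Qed.

(** * Parent maps that increase labels from a threshold on, and the topmost small ancestor *)

Definition decreasing k p : bool :=
  [forall v : 'I_n, (k <= v) ==> (if p v is Some u then v < u else true)].

Lemma decreasingP k p : reflect (forall v u, k <= v -> p v = Some u -> v < u) (decreasing k p).
Proof.
apply: (iffP forallP) => [D v u kv pv|D v].
  by have := D v; rewrite kv pv.
by apply/implyP => kv; case pv: (p v) => [u|] //; apply: D.
Qed.

(** Climbing from a label at least [k] only increases labels, so the climb never leaves the range
    where the hypothesis applies. *)
Lemma decreasing_desc k p i v : is_forest p -> decreasing k p ->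
  k <= v -> desc p i v -> v < i.
Proof.
move=> pF /decreasingP D; move: v; apply: (forest_ind pF) => v IH kv.
rewrite descE //; case pv: (p v) => [u|] //; have lt_vu := D _ _ kv pv.
case/orP=> [/eqP<-//|ui]; apply: (ltn_trans lt_vu).
by apply: IH ui => //; apply: leq_trans (ltnW lt_vu).
Qed.

(* For p decreasing from c.+1 on, r is the topmost vertex of label at most c
   among c and its ancestors. *)
Definition is_top p (c r : 'I_n) : bool :=
  [&& c \in subtree p r, r <= c & (if p r is Some u then c < u else true)].

Lemma exists_top p c : is_forest p -> exists r, is_top p c r.
Proof.
move=> pF.
suff /(_ c (leqnn c)) : forall v, v <= c ->
  exists r, [&& v \in subtree p r, r <= c & (if p r is Some u then c < u else true)].
  by [].
apply: (forest_ind pF) => v IH vc.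
case pv: (p v) => [u|]; last by exists v; rewrite setU11 vc pv.
case: (leqP u c) => [uc|cu]; last by exists v; rewrite setU11 vc pv.
have [r /and3P[ur rc pr]] := IH _ pv uc; exists r; rewrite rc pr !andbT.
by move: ur; rewrite !inE (descE r v) // pv => ->; rewrite orbT.
Qed.

Lemma top_above p c r i : is_forest p -> decreasing c.+1 p -> is_top p c r ->
  desc p i r -> c < i.
Proof.
move=> pF D /and3P[_ _ pr]; rewrite descE //; case: (p r) pr => [u|] // cu.
case/orP=> [/eqP<-//|ui]; exact: ltn_trans (decreasing_desc pF D cu ui).
Qed.

(** Both candidates are [c] or ancestors of [c], hence comparable, and [top_above] excludes that one
    is a proper ancestor of the other. *)
Lemma top_uniq p c r r' : is_forest p -> decreasing c.+1 p ->
  is_top p c r -> is_top p c r' -> r = r'.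
Proof.
move=> pF D tr tr'; have [cr rc _] := and3P tr; have [cr' r'c _] := and3P tr'.
apply/eqP; suff: [|| r == r', desc p r r' | desc p r' r].
  case/or3P=> // [/(top_above pF D tr')|/(top_above pF D tr)].
    by rewrite ltnNge rc.
  by rewrite ltnNge r'c.
move: cr cr'; rewrite !inE => /orP[/eqP<-|cr] /orP[/eqP<-|cr'].
- by rewrite eqxx.
- by rewrite cr' !orbT.
- by rewrite cr orbT.
exact: desc_comparable pF cr cr'.
Qed.

(** A descendant of [r] with label above [c] would have only larger labels above it, contradicting
    [r <= c]. *)
Lemma top_subtree_le p c r x : is_forest p -> decreasing c.+1 p -> is_top p c r ->
  x \in subtree p r -> x <= c.
Proof.
move=> pF D /and3P[_ rc _]; rewrite !inE => /orP[/eqP->//|rx].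
rewrite leqNgt; apply/negP=> cx; have := decreasing_desc pF D cx rx.
by rewrite ltnNge (leq_trans rc (ltnW cx)).
Qed.

Definition top p c : 'I_n := odflt c [pick r | is_top p c r].

Lemma topP p c : is_forest p -> is_top p c (top p c).
Proof.
move=> pF; rewrite /top; case: pickP => // no_r.
by have [r] := exists_top c pF; rewrite no_r.
Qed.

Lemma top_eq p c r : is_forest p -> decreasing c.+1 p -> is_top p c r -> top p c = r.
Proof. by move=> pF D tr; apply: top_uniq pF D (topP c pF) tr. Qed.

(** * One relabelling step, its inverse, and the statistics it preserves *)

Implicit Types (f g : {ffun 'I_n -> option 'I_n} * {ffun 'I_n -> 'I_n.+1}).

(* The pairs (p, j) obtained once the labels at least k have been treated; j is
   padded with 0 on the others, where inv is still read off p. *)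
Definition stage k f : bool :=
  [&& is_forest f.1, decreasing k f.1 &
   [forall v : 'I_n, if k <= v then f.2 v <= #|descs f.1 v| else f.2 v == ord0]].

Definition inversions p v := #|[set x in descs p v | x < v]|.

(** Interpolates between the two statistics: at [k = n] every weight is an inversion number, at
    [k = 0] every weight is a recorded value. *)
Definition weight k f v : nat := if v < k then inversions f.1 v else f.2 v.

Definition same_stat k l f g : Prop :=
  (forall i : nat, #|[set v | weight k f v == i]| = #|[set v | weight l g v == i]|) /\
  #|[set v | f.1 v == None]| = #|[set v | g.1 v == None]|.

Definition step (c : 'I_n) f :=
  let r := top f.1 c in let S := subtree f.1 r in
  (relabel (rotation S r c) f.1,
   [ffun v => if v == c then inord (rank S r) else f.2 v]).

Definition unstep (c : 'I_n) f :=
  let S := subtree f.1 c in let r := nth c (enum S) (f.2 c) in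
  (relabel (rotation S r c)^-1 f.1,
   [ffun v => if v == c then ord0 else f.2 v]).

Lemma top_rotation p c r : is_forest p -> decreasing c.+1 p -> is_top p c r ->
  let S := subtree p r in let t := rotation S r c in
  [/\ t r = c, forall x, x \notin S -> t x = x, t @: S = S &
    forall x y, x \in S :\ r -> y \in S :\ r -> (t x < t y) = (x < y)].
Proof.
move=> pF D tr; apply: rotationP; first exact: setU11.
  by case/and3P: tr.
by move=> x; apply: top_subtree_le.
Qed.

Lemma rank_subtree p r : rank (subtree p r) r = inversions p r.
Proof.
apply: eq_card => x; rewrite !inE; case: eqVneq => [->|//].
by rewrite ltnn !andbF.
Qed.

Lemma card_subtree p v : is_forest p -> #|subtree p v| = #|descs p v|.+1.
Proof. by move=> pF; rewrite cardsU1 inE desc_irr. Qed.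

Lemma rotation_fix_above p c r v : is_forest p -> decreasing c.+1 p -> is_top p c r ->
  c < v -> rotation (subtree p r) r c v = v.
Proof.
move=> pF D tr cv; have [_ tid _ _] := top_rotation pF D tr; apply: tid.
by apply: contraTN cv => /(top_subtree_le pF D tr); rewrite -leqNgt.
Qed.

(** The new parent of [c] is the old parent of [r], which exceeds [c] by the choice of [r]; labels
    above [c] are fixed, and so are their parents. *)
Lemma decreasing_rotate p c r : is_forest p -> decreasing c.+1 p -> is_top p c r ->
  decreasing c (relabel (rotation (subtree p r) r c) p).
Proof.
move=> pF D tr; have [tr_c _ _ _] := top_rotation pF D tr.
have fixed := rotation_fix_above pF D tr.
move: fixed tr_c; set t := rotation _ _ _ => fixed tr_c.
apply/decreasingP=> v u; rewrite leq_eqVlt => /orP[/eqP/val_inj<-|cv].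
  rewrite -{1}tr_c relabelE; case/and3P: tr => _ _; case: (p r) => //= w cw [<-].
  by rewrite fixed.
rewrite -{1}(fixed _ cv) relabelE; case pv: (p v) => [w|] //= [<-].
have vw := decreasingP _ _ D _ _ cv pv.
by rewrite fixed // (ltn_trans cv).
Qed.

Lemma inversions_rotate p c r v : is_forest p -> decreasing c.+1 p -> is_top p c r ->
  v != r -> v <= c ->
  let t := rotation (subtree p r) r c in
  inversions (relabel t p) (t v) = inversions p v.
Proof.
move=> pF D tr vr vc /=; have [_ tid _ tmon] := top_rotation pF D tr.
move: tid tmon; set S := subtree p r; set t := rotation _ _ _ => tid tmon.
(* It is enough that [t] keeps the order between [v] and each descendant [x]. If [v] is in [S], both
   lie in [S :\ r], where [t] is increasing. Otherwise neither is in [S]: with [x] in [S], [v] would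
   be an ancestor of [r] and exceed [c]. *)
suff tlt x : desc p v x -> (t x < t v) = (x < v).
  rewrite /inversions -[RHS](card_imset _ (@perm_inj _ t)).
  apply: eq_card => x; rewrite -(permKV t x) mem_imset; last exact: perm_inj.
  by rewrite !inE relabel_desc; case vx: (desc p v _); rewrite //= tlt.
move=> vx; have [vS|vS] := boolP (v \in S).
  have rv : desc p r v by move: vS; rewrite !inE (negPf vr).
  have rx := desc_trans pF rv vx.
  rewrite tmon // !inE ?rv ?rx ?orbT ?andbT //.
  by apply: contraTneq rx => ->; rewrite desc_irr.
rewrite (tid _ vS) tid //; apply: contra vS; rewrite !inE => /orP[/eqP E|rx].
  by have := top_above pF D tr (i := v); rewrite -E vx ltnNge vc => /(_ isT).
case/or3P: (desc_comparable pF rx vx) => [|->|/(top_above pF D tr)].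
- by rewrite eq_sym => ->.
- by rewrite orbT.
by rewrite ltnNge vc.
Qed.

Lemma card_descs_relabel t p v : #|descs (relabel t p) (t v)| = #|descs p v|.
Proof. by rewrite relabel_descs card_imset //; apply: perm_inj. Qed.

Lemma stageP k p (j : {ffun 'I_n -> 'I_n.+1}) :
  reflect [/\ is_forest p, decreasing k p,
    forall v, k <= v -> j v <= #|descs p v| & forall v, v < k -> j v = ord0]
  (stage k (p, j)).
Proof.
apply: (iffP and3P) => [[pF D /forallP H]|[pF D H1 H2]]; split=> //.
- by move=> v kv; have := H v; rewrite /= kv.
- by move=> v vk; have := H v; rewrite /= leqNgt vk => /eqP.
apply/forallP=> v /=; case: leqP => [/H1//|/H2->]; exact: eqxx.
Qed.

Lemma inversions_le_descs p v : inversions p v <= #|descs p v|.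
Proof. by apply: subset_leq_card; apply/subsetP=> x; rewrite inE => /andP[]. Qed.

Lemma inversionsK p v : (inord (inversions p v) : 'I_n.+1) = inversions p v :> nat.
Proof. by rewrite inordK // ltnS (leq_trans (max_card _)) // card_ord. Qed.

Lemma step_stage c f : stage c.+1 f -> stage c (step c f).
Proof.
case: f => p j /stageP[pF D H1 H2]; rewrite /step /=.
have tr := topP c pF; move: (top p c) tr => r tr.
have [tr_c _ _ _] := top_rotation pF D tr.
have fixed := rotation_fix_above pF D tr.
apply/stageP; split; first exact: relabel_forest.
- exact: decreasing_rotate.
- move=> v; rewrite ffunE leq_eqVlt => /orP[/eqP/val_inj<-|cv].
    rewrite eqxx rank_subtree inversionsK -{2}tr_c card_descs_relabel.
    exact: inversions_le_descs.
  have /negPf-> : v != c by apply: contraTneq cv => ->; rewrite ltnn.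
  by rewrite -{2}(fixed v cv) card_descs_relabel H1.
move=> v vc; rewrite ffunE; have /negPf-> : v != c by apply: contraTneq vc => ->; rewrite ltnn.
by rewrite H2 // ltnS ltnW.
Qed.

(** The rotation matches vertices of equal weight: the inversion number of [r] becomes the recorded
    value at [c], and every other weight is carried along. Relabelling also preserves roots. *)
Lemma step_same_stat c f : stage c.+1 f -> same_stat c.+1 c f (step c f).
Proof.
case: f => p j /stageP[pF D H1 H2]; rewrite /step /=.
have tr := topP c pF; move: (top p c) tr => r tr.
have [tr_c _ _ _] := top_rotation pF D tr.
have fixed := rotation_fix_above pF D tr.
have invE := inversions_rotate pF D tr.
have rkE := rank_subtree p r.
have rc : r <= c by case/and3P: tr.
move: fixed tr_c invE; set t := rotation _ _ _ => fixed tr_c /= invE.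
split=> [i|]; rewrite -(card_imset _ (@perm_inj _ t)); apply: eq_card => x;
  rewrite -(permKV t x) mem_imset ?inE; try exact: perm_inj; last first.
  by rewrite relabelE; case: (p _).
move: (t^-1 x)%g => v {x}; rewrite /weight /= ffunE ltnS.
have [->|vr] := eqVneq v r.
  by rewrite tr_c eqxx ltnn rkE rc inversionsK.
have /negPf tvc : t v != c by rewrite -tr_c (inj_eq perm_inj).
rewrite tvc; case: (leqP v c) => vc; last by rewrite fixed // ltnNge ltnW.
suff -> : t v < c by rewrite invE.
have [_ tid tS _] := top_rotation pF D tr.
rewrite ltn_neqAle (inj_eq val_inj) tvc /=.
have [vS|vS] := boolP (v \in subtree p r); last by rewrite [t v]tid.
by apply: (top_subtree_le pF D tr); rewrite -tS imset_f.
Qed.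

(** The rotation permutes [S] and sends [r] to [c], so [S] is still visible afterwards, as the
    subtree at [c]. *)
Lemma subtree_rotate p c r : is_forest p -> decreasing c.+1 p -> is_top p c r ->
  subtree (relabel (rotation (subtree p r) r c) p) c = subtree p r.
Proof.
move=> pF D tr; have [tr_c _ tS _] := top_rotation pF D tr.
by rewrite -{2}tr_c relabel_subtree tS.
Qed.

Lemma stepK c f : stage c.+1 f -> unstep c (step c f) = f.
Proof.
case: f => p j /stageP[pF D H1 H2]; rewrite /step /unstep /=.
have tr := topP c pF; move: (top p c) tr => r tr.
rewrite subtree_rotate // ffunE eqxx rank_subtree inversionsK -rank_subtree.
rewrite nth_enum_rank ?setU11 // relabelK; congr pair.
by apply/ffunP=> v; rewrite !ffunE; case: eqVneq => // ->; rewrite H2.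
Qed.

(** Since [q] is decreasing from [c] on, [c] is the maximum of its subtree. Any [r] in that subtree
    may thus take its place, and it becomes the top because the parent of [c] exceeds [c]. *)
Lemma unrotate q c r : is_forest q -> decreasing c q -> r \in subtree q c ->
  let p := relabel (rotation (subtree q c) r c)^-1 q in
  [/\ is_forest p, decreasing c.+1 p, is_top p c r & subtree p r = subtree q c].
Proof.
move=> qF D rS /=; have cS : c \in subtree q c by apply: setU11.
have cmax x : x \in subtree q c -> x <= c.
  rewrite !inE => /orP[/eqP->//|cx]; rewrite leqNgt; apply/negP=> lt_cx.
  have := decreasing_desc qF D (ltnW lt_cx) cx.
  by rewrite ltnNge ltnW.
have [tr_c tid tS _] := rotationP rS cS cmax.
have fixed v : c < v -> (rotation (subtree q c) r c)^-1%g v = v.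
  move=> cv; apply: (canLR (permK _)); rewrite tid //.
  by apply: contraTN cv => /cmax; rewrite -leqNgt.
move: tr_c tid tS fixed; set t := rotation _ _ _ => tr_c tid tS fixed.
have tVc : (t^-1)%g c = r by apply: (canLR (permK _)).
have sub_r : subtree (relabel t^-1 q) r = subtree q c.
  by rewrite -{1}tVc relabel_subtree -{1}tS -imset_comp (eq_imset _ (permK t)) imset_id.
have D' := decreasingP _ _ D.
split=> //; first exact: relabel_forest.
- apply/decreasingP=> v u cv; rewrite -{1}(fixed _ cv) relabelE.
  case qv: (q v) => [w|] //= [<-].
  have vw := D' _ _ (ltnW cv) qv.
  by rewrite fixed // (ltn_trans cv).
- apply/and3P; split; rewrite ?sub_r ?cmax //.
  rewrite -tVc relabelE; case qc: (q c) => [w|] //=.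
  have cw := D' _ _ (leqnn c) qc.
  by rewrite fixed.
Qed.

Lemma unstep_stage c f : stage c f -> stage c.+1 (unstep c f).
Proof.
case: f => q j /stageP[qF D H1 H2]; rewrite /unstep /=.
(* The recorded value is at most the number of descendants, one less than the size of [S], so some
   element of [S] has this rank. *)
have lt_j : j c < #|subtree q c| by rewrite card_subtree // ltnS H1.
have [rS _] := rank_nth_enum c lt_j; move: (nth _ _ _) rS => r rS.
have [pF pD tr sub_r] := unrotate qF D rS.
apply/stageP; split=> // v cv; rewrite ffunE; last first.
  case: eqVneq => // vc; apply: H2.
  by rewrite ltn_neqAle (inj_eq val_inj) vc.
have /negPf-> : v != c by apply: contraTneq cv => ->; rewrite ltnn.
rewrite (leq_trans (H1 v (ltnW cv))) //.
have fixed := rotation_fix_above pF pD tr cv; rewrite sub_r in fixed.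
by rewrite -[leqRHS](card_descs_relabel (rotation (subtree q c) r c)) relabelVK fixed.
Qed.

Lemma unstepK c f : stage c f -> step c (unstep c f) = f.
Proof.
case: f => q j /stageP[qF D H1 H2]; rewrite /step /unstep /=.
have lt_j : j c < #|subtree q c| by rewrite card_subtree // ltnS H1.
have [rS rkE] := rank_nth_enum c lt_j; move: (nth _ _ _) rS rkE => r rS rkE.
have [pF pD tr sub_r] := unrotate qF D rS.
rewrite (top_eq pF pD tr) sub_r relabelVK; congr pair.
apply/ffunP=> v; rewrite !ffunE; case: eqVneq => // ->.
by rewrite rkE; apply: val_inj; rewrite /= inordK.
Qed.

End ForestMaps.

(** * Permutations and decreasing forests *)

Lemma card_ord_lt n k : k <= n -> #|[set t : 'I_n | t < k]| = k.
Proof.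
move=> kn; rewrite -sum1_card (eq_bigl (fun t : 'I_n => t < k)); last by move=> t; rewrite inE.
by rewrite -(big_ord_widen _ (fun=> 1) kn) sum1_card card_ord.
Qed.

Section Arrangements.
Variable n : nat.
Implicit Types (w : {perm 'I_n}) (c d : 'I_n).

Lemma card_perm_lt w k : k <= n -> #|[set c : 'I_n | w c < k]| = k.
Proof.
move=> kn; rewrite -[RHS](card_ord_lt kn) -(card_imset _ (@perm_inj _ w)).
apply: eq_card => t; rewrite -(permKV w t) mem_imset ?inE //; exact: perm_inj.
Qed.

Lemma card_perm_between w a b : a <= b -> b <= n ->
  #|[set c : 'I_n | a <= w c < b]| = b - a.
Proof.
move=> ab bn; rewrite -{2}(card_perm_lt w bn) -{2}(card_perm_lt w (leq_trans ab bn)).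
rewrite -cardsDS; last by apply/subsetP=> c; rewrite !inE => /leq_trans->.
by apply: eq_card => c; rewrite !inE -leqNgt.
Qed.

(** Here [w c] is the space, counted from 0, taken by car [c]; the value is the closest car to the
    right with a larger number. *)
Definition next_larger w : {ffun 'I_n -> option 'I_n} :=
  [ffun c : 'I_n => [pick d : 'I_n | [&& c < d, w c < w d &
     [forall e : 'I_n, (c < e) && (w c < w e) ==> (w d <= w e)]]]].

Variant next_larger_spec w c : option 'I_n -> Prop :=
| NextLarger d of c < d & w c < w d &
    (forall e : 'I_n, c < e -> w c < w e -> w d <= w e) : next_larger_spec w c (Some d)
| NoLarger of (forall e : 'I_n, w c < w e -> e < c) : next_larger_spec w c None.

Lemma next_largerP w c : next_larger_spec w c (next_larger w c).
Proof.
rewrite ffunE; case: pickP => [d /and3P[cd wcd /forallP dmin]|none].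
  by constructor=> // e ce wce; apply: (implyP (dmin e)); rewrite ce.
constructor=> e wce; rewrite ltnNge leq_eqVlt; apply/norP; split.
  by apply: contraTneq wce => /val_inj->; rewrite ltnn.
apply/negP=> ce; have e_ok : (c < e) && (w c < w e) by rewrite ce.
case: (@arg_minnP _ e (fun x : 'I_n => (c < x) && (w c < w x)) (fun x => w x) e_ok) => d /andP[cd wcd] dmin.
have := none d; rewrite cd wcd /=; case/forallP=> x; apply/implyP; exact: dmin.
Qed.

Lemma next_larger_order w c d : c < d ->
  (w c < w d) = if next_larger w c is Some e then w e <= w d else false.
Proof.
move=> cd; case: next_largerP => [e ce wce emin|none].
  by apply/idP/idP => [|/(leq_trans wce)//]; apply: emin.
by apply/negP=> /none; rewrite ltnNge ltnW.
Qed.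

(** The relative order of the cars is rebuilt by inserting them from the largest to the smallest:
    [next_larger_order] places [c] using comparisons among larger cars only. *)
Lemma next_larger_inj : injective next_larger.
Proof.
move=> w w' E.
have order m : forall c d, n - m <= c -> n - m <= d -> (w c <= w d) = (w' c <= w' d).
  elim: m => [|m IH] c d.
    by rewrite subn0 leqNgt ltn_ord.
  have lt_case (a b : 'I_n) : n - m.+1 <= a -> a < b -> (w a < w b) = (w' a < w' b).
    move=> ma ab; rewrite !next_larger_order // -E; case: next_largerP => // e ae _ _.
    apply: IH; lia.
  move=> mc md; case: (ltngtP c d) => [cd|dc|/val_inj->]; last by rewrite !leqnn.
    have neq (u : {perm 'I_n}) : (u c <= u d) = (u c < u d).
      by rewrite ltn_neqAle (inj_eq val_inj) (inj_eq perm_inj) -(inj_eq val_inj) ltn_eqF.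
    by rewrite !neq lt_case.
  by rewrite leqNgt [RHS]leqNgt lt_case.
apply/permP=> c; apply: val_inj.
(* The space of [c] is the number of cars to its left, so the order determines the permutation. *)
rewrite /= -(card_perm_lt w (ltnW (ltn_ord (w c)))) -(card_perm_lt w' (ltnW (ltn_ord (w' c)))).
by apply: eq_card => d; rewrite !inE !ltnNge (order n) // subnn.
Qed.

Lemma next_larger_decreasing w : decreasing 0 (next_larger w).
Proof. by apply/decreasingP=> v u _; case: next_largerP => // d vd _ _ [<-]. Qed.

Lemma decreasing_forest (p : {ffun 'I_n -> option 'I_n}) : decreasing 0 p -> is_forest p.
Proof.
move=> /decreasingP D; apply/forallP => v.
have up k u : iter k (pstep p) (Some v) = Some u -> v + k <= u.
  elim: k u => [|k IH] u /=; first by case=> ->; rewrite addn0.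
  case E: (iter _ _ _) => [x|] //= px; have := IH _ E; have := D _ _ (leq0n _) px; lia.
case E: (iter _ _ _) => [u|] //; have := up _ _ E; have := ltn_ord u; lia.
Qed.

(** Vertex [v] has at most [n - v] admissible values, namely [None] and the larger labels; their
    product is the factorial. *)
Lemma card_decreasing : #|[set p : {ffun 'I_n -> option 'I_n} | decreasing 0 p]| <= n`!.
Proof.
pose A (v : 'I_n) := [pred o : option 'I_n | if o is Some u then v < u else true].
rewrite (@eq_card _ _ (mem (family A))); last first.
  by move=> p; rewrite inE; apply: eq_forallb => v; rewrite /= inE.
rewrite card_family foldrE big_image fact_prod big_add1 /= big_mkord.
rewrite (reindex_inj rev_ord_inj) /=; apply: leq_prod => v _.
(* [None] is encoded as the extra top element of ['I_n.+1], so that all admissible values lie above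
   a common threshold. *)
have f_inj : injective (oapp (lift ord_max) ord_max : option 'I_n -> 'I_n.+1).
  move=> [x|] [y|] //=; first by move/lift_inj->.
    by move/eqP; rewrite eq_sym (negPf (neq_lift _ _)).
  by move/eqP; rewrite (negPf (neq_lift _ _)).
rewrite -(card_imset _ f_inj).
apply: (@leq_trans #|~: [set t : 'I_n.+1 | t < (rev_ord v).+1]|).
  apply: subset_leq_card; apply/subsetP=> _ /imsetP[o o_gt ->]; rewrite !inE -leqNgt.
  case: o o_gt => [x vx|_]; first by rewrite -[oapp _ _ _]/(lift ord_max x) lift_max; exact: vx.
  exact: (ltn_ord (rev_ord v)).
have le_v : (rev_ord v).+1 <= n.+1 by rewrite ltnS ltnW.
have := cardsC [set t : 'I_n.+1 | t < (rev_ord v).+1].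
rewrite (card_ord_lt le_v) card_ord /=; have := ltn_ord v; lia.
Qed.

(** By counting: an injection from [n]! permutations into a set of at most [n]! maps is onto. *)
Lemma next_larger_surj (p : {ffun 'I_n -> option 'I_n}) : decreasing 0 p ->
  exists w, next_larger w = p.
Proof.
move=> D; suff: p \in next_larger @: setT by case/imsetP=> w _ ->; exists w.
have/eqP -> : next_larger @: setT == [set p | decreasing 0 p]; last by rewrite inE.
rewrite eqEcard (card_imset _ next_larger_inj) cardsT; apply/andP; split.
  by apply/subsetP=> _ /imsetP[w _ ->]; rewrite inE next_larger_decreasing.
by rewrite card_Sn card_decreasing.
Qed.

Lemma desc_next_larger w d c :
  reflect (w c < w d /\ forall e, w c <= w e -> w e < w d -> e < d)
    (desc (next_larger w) d c).
Proof.
have pF := decreasing_forest (next_larger_decreasing w).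
apply: (iffP idP).
  move: c; apply: (forest_ind pF) => c IH; rewrite descE //.
  case: next_largerP IH => // e ce wce emin IH /orP[/eqP<-|].
    split=> // x cx xe; rewrite ltnNge; apply/negP=> ex.
    have := emin x; have : w c != w x by rewrite (inj_eq perm_inj) -(inj_eq val_inj) /=; lia.
    rewrite -(inj_eq val_inj) /=; lia.
  case/(IH _ erefl)=> ed run; split=> [|x cx xd]; first exact: ltn_trans ed.
  have lt_ed : e < d by apply: run.
  case: (leqP (w e) (w x)) => [ex|xe]; first exact: run.
  rewrite ltnNge; apply/negP=> dx; have := emin x.
  have : w c != w x by rewrite (inj_eq perm_inj) -(inj_eq val_inj) /=; lia.
  rewrite -(inj_eq val_inj) /=; lia.
move: c; apply: (forest_ind pF) => c IH [cd run]; rewrite descE //.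
have lt_cd : c < d by apply: run.
case: next_largerP IH => [e ce wce emin IH|none _]; last by have := none _ cd; lia.
have [//|ned /=] := eqVneq e d; apply: (IH _ erefl).
have : w e != w d by rewrite (inj_eq perm_inj).
rewrite -(inj_eq val_inj) /= => neq.
have led := emin d lt_cd cd.
split=> [|x ex xd]; first by lia.
by apply: run => //; lia.
Qed.

(** The descendants of [d] fill the maximal block of smaller cars ending just before [d]. A larger
    car among the [k] preceding spaces would confine them to fewer than [k] spaces. *)
Lemma leq_descs_next_larger w d k :
  reflect (k <= w d /\ forall c, w d - k <= w c -> w c < w d -> c < d)
    (k <= #|descs (next_larger w) d|).
Proof.
have wd_n : w d <= n := ltnW (ltn_ord _).
apply: (iffP idP) => [le_k|[kd run]].
  split=> [|c kc cd].
    apply: leq_trans le_k _; rewrite -(card_perm_lt w wd_n); apply: subset_leq_card.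
    by apply/subsetP=> x; rewrite !inE => /desc_next_larger[].
  rewrite ltnNge; apply/negP=> dc.
  suff : #|descs (next_larger w) d| <= w d - (w c).+1 by lia.
  rewrite -(card_perm_between w cd wd_n); apply: subset_leq_card.
  apply/subsetP=> x; rewrite !inE => /desc_next_larger[xd xrun]; rewrite xd andbT.
  by rewrite ltnNge; apply/negP=> xc; have := xrun _ xc cd; lia.
rewrite -{1}(subKn kd) -(card_perm_between w (leq_subr _ _) wd_n); apply: subset_leq_card.
apply/subsetP=> x; rewrite !inE => /andP[kx xd]; apply/desc_next_larger; split=> // e xe ed.
by apply: run => //; apply: leq_trans xe.
Qed.

End Arrangements.

(** * Parking *)

Lemma first_free_spec f occ a : let q := first_free f occ a in
  [/\ a <= q, forall t, a <= t < q -> t \in occ & (q \notin occ) || (q == a + f)].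
Proof.
elim: f a => [|f IH] a /=; first by split=> // [t|]; [lia | rewrite addn0 eqxx orbT].
case: ifPn => [aocc|aocc]; last by split; rewrite ?aocc //; lia.
have [le_q between last] := IH a.+1; split; first exact: ltnW.
  move=> t /andP[]; rewrite leq_eqVlt => /orP[/eqP<-//|lt_at] tq.
  by apply: between; rewrite lt_at.
by rewrite addnS -addSn.
Qed.

(** The fuel suffices by pigeonhole: [(size occ).+1] consecutive spaces cannot all belong to
    [occ]. *)
Lemma first_freeP occ a : let q := first_free (size occ).+1 occ a in
  [/\ a <= q, forall t, a <= t < q -> t \in occ & q \notin occ].
Proof.
have [le_q between last] := first_free_spec (size occ).+1 occ a; split=> //.
case/orP: last => // /eqP qE.
suff : size (iota a (size occ).+1) <= size occ by rewrite size_iota ltnn.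
apply: uniq_leq_size; first exact: iota_uniq.
by move=> t; rewrite mem_iota -qE; apply: between.
Qed.

(** A specification of the parking outcome free of the algorithm; [parks_uniq] shows that it
    determines [q]. *)
Definition parks (s q : seq nat) : Prop := size q = size s /\
  forall i, i < size s -> [/\ nth 0 s i <= nth 0 q i,
    nth 0 q i \notin take i q &
    forall t, nth 0 s i <= t < nth 0 q i -> t \in take i q].

Lemma parks_spots s : parks s (spots s).
Proof.
elim/last_ind: s => [|s a [szE IH]]; first by split.
rewrite /spots -cats1 foldl_cat /= -/(spots s) /park_step cats1.
split=> [|i]; first by rewrite !size_rcons szE.
rewrite size_rcons ltnS => le_i.
have -> x : take i (rcons (spots s) x) = take i (spots s).
  by rewrite -cats1 takel_cat // szE.
rewrite !nth_rcons szE; move: le_i; rewrite leq_eqVlt => /orP[/eqP->|lt_i].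
  rewrite ltnn eqxx -szE take_size; have [? ? ?] := first_freeP (spots s) a.
  by split.
by rewrite lt_i; apply: IH.
Qed.

Lemma parks_uniq s q q' : parks s q -> parks s q' -> q = q'.
Proof.
move=> [szq Hq] [szq' Hq'].
suff takeE k : k <= size s -> take k q = take k q'.
  by have := takeE _ (leqnn _); rewrite -{1}szq -szq' !take_size.
elim: k => [|k IH] lt_k; first by rewrite !take0.
rewrite !(take_nth 0) ?szq ?szq' // (IH (ltnW lt_k)); congr rcons.
have [l1 n1 b1] := Hq k lt_k; have [l2 n2 b2] := Hq' k lt_k.
rewrite (IH (ltnW lt_k)) in n1 b1.
(* If the spaces differed, the smaller one would be free according to one outcome and already taken
   according to the other. *)
case: (ltngtP (nth 0 q k) (nth 0 q' k)) => // lt_q.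
  by move: n1; rewrite b2 // l1.
by move: n2; rewrite b1 // l2.
Qed.

Lemma parks_seq_uniq s q : parks s q -> uniq q.
Proof.
move=> [szq Hq]; rewrite -[q]take_size szq.
elim: {-2}(size s) (leqnn (size s)) => [|k IH] lt_k; first by rewrite take0.
rewrite (take_nth 0) ?szq // rcons_uniq IH ?(ltnW lt_k) // andbT.
by have [] := Hq k lt_k.
Qed.

(** * Parking functions as parking orders with admissible jumps *)

Section Parking.
Variable n : nat.
Implicit Types (w : {perm 'I_n}) (j : {ffun 'I_n -> 'I_n.+1}) (c d : 'I_n).

Definition outcome w : seq nat := [seq (w c).+1 | c <- enum 'I_n].
Definition prefs w j : seq nat := [seq (w c).+1 - j c | c <- enum 'I_n].

Lemma size_outcome w : size (outcome w) = n.
Proof. by rewrite size_map size_enum_ord. Qed.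

Lemma size_prefs w j : size (prefs w j) = n.
Proof. by rewrite size_map size_enum_ord. Qed.

Lemma nth_outcome w c : nth 0 (outcome w) c = (w c).+1.
Proof. by rewrite (nth_map c) ?size_enum_ord // nth_ord_enum. Qed.

Lemma nth_prefs w j c : nth 0 (prefs w j) c = (w c).+1 - j c.
Proof. by rewrite (nth_map c) ?size_enum_ord // nth_ord_enum. Qed.

Lemma mem_take_outcome w c t :
  reflect (exists2 d : 'I_n, d < c & (w d).+1 = t) (t \in take c (outcome w)).
Proof.
apply: (iffP (nthP 0)) => [[i]|[d dc <-]].
  rewrite size_take size_outcome ltn_ord => ic.
  have lt_in : i < n by apply: ltn_trans ic _.
  by rewrite nth_take // (nth_outcome w (Ordinal lt_in)); exists (Ordinal lt_in).
by exists d; rewrite ?size_take ?size_outcome ?ltn_ord // nth_take ?nth_outcome.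
Qed.

Definition fits w j : Prop := forall c, j c <= #|descs (next_larger w) c|.

(** The spaces that car [c] jumps over hold smaller cars, which arrived earlier, so the outcome
    meets the specification [parks]. *)
Lemma spots_prefs w j : fits w j -> spots (prefs w j) = outcome w.
Proof.
move=> fit; apply: (parks_uniq (parks_spots _)); split=> [|i].
  by rewrite size_prefs size_outcome.
rewrite size_prefs => lt_i; pose c := Ordinal lt_i; rewrite -[i]/(val c).
rewrite nth_prefs nth_outcome; have /leq_descs_next_larger[jw run] := fit c.
split; first exact: leq_subr.
  by apply/mem_take_outcome=> -[d dc [/val_inj/perm_inj E]]; rewrite E ltnn in dc.
case=> [|t]; first by lia.
move=> /andP[le_t lt_t]; have tn : t < n by have := ltn_ord (w c); lia.
apply/mem_take_outcome; exists (w^-1 (Ordinal tn))%g; last by rewrite permKV.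
by apply: run; rewrite permKV /=; lia.
Qed.

Lemma prefs_parking w j : fits w j -> is_parking_function n (prefs w j).
Proof.
move=> fit; apply/and3P; split; first by rewrite size_prefs.
  apply/allP=> _ /mapP[c _ ->]; have /leq_descs_next_larger[jw _] := fit c.
  by rewrite subn_gt0 ltnS.
by rewrite spots_prefs //; apply/allP=> _ /mapP[c _ ->].
Qed.

Lemma prefs_inj w j w' j' : fits w j -> fits w' j' -> prefs w j = prefs w' j' ->
  w = w' /\ j = j'.
Proof.
move=> fit fit' E.
have ww' : w = w'.
  apply/permP=> c; apply/val_inj/succn_inj.
  by rewrite -!nth_outcome -(spots_prefs fit) -(spots_prefs fit') E.
split=> //; apply/ffunP=> c; apply: val_inj => /=.
have := nth_prefs w j c; rewrite E nth_prefs ww'.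
have /leq_descs_next_larger[jw _] := fit c.
have /leq_descs_next_larger[jw' _] := fit' c.
rewrite ww' in jw; lia.
Qed.

(** The spaces taken are distinct and lie between 1 and [n], so they form a permutation [w]; [j] is
    the displacement, and the spaces jumped over give [fits]. *)
Lemma parking_prefs s : is_parking_function n s ->
  exists w j, fits w j /\ prefs w j = s.
Proof.
case/and3P=> /eqP szs /allP s_gt0 /allP q_le.
have [szq park] := parks_spots s; have uq := parks_seq_uniq (parks_spots s).
move: (spots s) q_le szq park uq => q q_le szq park uq; rewrite szs in szq park.
have q_gt0 c : 0 < nth 0 q c.
  have [le_sq _ _] := park c (ltn_ord c); apply: leq_trans le_sq.
  by apply: s_gt0; rewrite mem_nth ?szs.
have q_n c : (nth 0 q c).-1 < n by rewrite prednK // q_le // mem_nth ?szq.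
have q_inj : injective (fun c => Ordinal (q_n c)).
  have ltq (x : 'I_n) : val x < size q by rewrite szq; apply: ltn_ord.
  move=> c d [E]; apply/val_inj/eqP; rewrite -(nth_uniq 0 (ltq c) (ltq d) uq).
  by rewrite -(prednK (q_gt0 c)) E prednK.
pose w : {perm 'I_n} := perm q_inj.
have wE c : (w c).+1 = nth 0 q c by rewrite permE /= prednK.
clearbody w.
have qE : q = outcome w.
  apply: (@eq_from_nth _ 0) => [|i]; rewrite szq ?size_outcome // => lt_i.
  by rewrite -[i]/(val (Ordinal lt_i)) nth_outcome wE.
pose j : {ffun 'I_n -> 'I_n.+1} := [ffun c : 'I_n => inord ((w c).+1 - nth 0 s c)].
have jE c : j c = (w c).+1 - nth 0 s c :> nat.
  by rewrite ffunE inordK // ltnS; have := ltn_ord (w c); lia.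
clearbody j; have s0 c : 0 < nth 0 s c by apply: s_gt0; rewrite mem_nth ?szs.
exists w, j; split=> [c|].
  apply/leq_descs_next_larger; rewrite jE; have := s0 c.
  have [] := park c (ltn_ord c); rewrite -wE; move: (nth 0 s c) => m le_m _ run m0.
  split=> [|d le_d dc]; first by lia.
  have /run : m <= (w d).+1 < (w c).+1 by lia.
  by rewrite qE => /mem_take_outcome[e ec [/val_inj/perm_inj<-]].
apply: (@eq_from_nth _ 0) => [|i]; rewrite size_prefs ?szs // => lt_i.
rewrite -[i]/(val (Ordinal lt_i)) nth_prefs jE subKn // wE.
by have [] := park _ (ltn_ord (Ordinal lt_i)).
Qed.

(** * Comparison of the statistics and composition of the steps *)

Lemma count_iota_ord (P : pred nat) : count P (iota 0 n) = #|[set c : 'I_n | P c]|.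
Proof.
rewrite -val_enum_ord count_map cardE [in RHS]/enum_mem size_filter enumT.
by apply: eq_count => c; rewrite /= inE.
Qed.

Lemma jump_prefs w j c : fits w j -> jump (prefs w j) c = j c.
Proof.
move=> fit; rewrite /jump spots_prefs // nth_outcome nth_prefs subKn //.
by have /leq_descs_next_larger[/leqW] := fit c.
Qed.

Lemma critical_prefs w j c : fits w j ->
  critical n (prefs w j) c = (next_larger w c == None).
Proof.
move=> fit; rewrite /critical spots_prefs // nth_outcome.
have wn d : (w d).+1 <= n by apply: ltn_ord.
apply/allP/eqP => [full|none t].
  case: next_largerP => // d cd wcd _.
  have /full/mem_take_outcome[e ec [/val_inj/perm_inj ed]] : (w d).+1 \in iota (w c).+2 (n - (w c).+1).
    by rewrite mem_iota; have := wn c; have := wn d; lia.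
  by rewrite ed ltnNge ltnW in ec.
rewrite mem_iota => t_in; have wcn := wn c.
have tn : t.-1 < n by lia.
apply/mem_take_outcome; exists (w^-1 (Ordinal tn))%g; last by rewrite permKV /=; lia.
by case: next_largerP none => // none _; apply: none; rewrite permKV /=; lia.
Qed.

Lemma descendant_desc (F : forest n) c d : descendant F c d = desc (val F) c d.
Proof.
rewrite /descendant -/(desc (val F) c d); case: eqVneq => // ->.
by rewrite desc_irr //; apply: valP.
Qed.

Lemma inv_inversions (F : forest n) c : Defs.inv F c = inversions (val F) c.
Proof. by apply: eq_card => x; rewrite !inE descendant_desc. Qed.

Lemma same_stat_trans k l m f g h :
  @same_stat n k l f g -> same_stat l m g h -> same_stat k m f h.
Proof. by move=> [E1 E2] [E3 E4]; split=> [i|]; rewrite ?E1 ?E2 ?E3 ?E4. Qed.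

(** Labels are treated from [n - 1] downwards; [f] composes the first [m] steps and [g] their
    inverses. *)
Lemma stage_bijection m : m <= n -> exists f g,
  (forall y, @stage n n y ->
     [/\ stage (n - m) (f y), g (f y) = y & same_stat n (n - m) y (f y)]) /\
  (forall z, stage (n - m) z -> stage n (g z) /\ f (g z) = z).
Proof.
elim: m => [|m IH] lt_m; first by exists id, id; rewrite subn0; split.
have [f [g [fP gP]]] := IH (ltnW lt_m).
have lt_c : n - m.+1 < n by lia.
pose c := Ordinal lt_c; have cE : n - m = c.+1 by rewrite /=; lia.
rewrite cE in fP gP; exists (step c \o f), (g \o unstep c); split=> [y|z] Hy /=.
  have [fy gfy st] := fP y Hy; split; first exact: (step_stage fy).
    by rewrite stepK.
  exact: same_stat_trans st (step_same_stat fy).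
have uz := unstep_stage (c := c) Hy; have [gz fgz] := gP _ uz.
by rewrite fgz unstepK.
Qed.

End Parking.

(** * Assembly of the bijection *)

Theorem mainTheorem1 (n : nat) (Hn : 1 <= n) :
  exists phi : forest n -> parking_function n,
    bijective phi /\
    forall F : forest n, (tinv F, tree F) = (tjump (phi F), critic (phi F)).
Proof.
have [f [g [fP gP]]] := stage_bijection (leqnn n); rewrite subnn in fP gP.
(* No label has been treated yet, so the recorded values are all the padding 0. *)
pose start (F : forest n) : _ * {ffun 'I_n -> 'I_n.+1} := (val F, [ffun=> ord0]).
have startP F : stage n (start F).
  apply/stageP; split=> [||v|v _]; rewrite ?ffunE //; first exact: valP.
  by apply/decreasingP=> v u; rewrite leqNgt ltn_ord.
pose w F := odflt 1%g [pick w : {perm 'I_n} | next_larger w == (f (start F)).1].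
have wE F : next_larger (w F) = (f (start F)).1.
  rewrite /w; case: pickP => [u /eqP//|none].
  have [/and3P[_ D _] _ _] := fP _ (startP F).
  by have [u /eqP] := next_larger_surj D; rewrite none.
have fit F : fits (w F) (f (start F)).2.
  move=> c; rewrite wE; have [+ _ _] := fP _ (startP F).
  by case: (f _) => p j /stageP[_ _ H _]; apply: H.
pose phi F : parking_function n :=
  exist (fun s : seq nat => is_parking_function n s) _ (prefs_parking (fit F)).
exists phi; split; last first.
  move=> F; have [_ _ [st tr]] := fP _ (startP F); congr pair.
    apply: eq_mkseq => i; rewrite /lucky count_iota_ord /lead.
    transitivity #|[set v | weight n (start F) v == i]|.
      by apply: eq_card => v; rewrite !inE /weight ltn_ord inv_inversions.
    by apply: etrans (st i) _; apply: eq_card => v; rewrite !inE jump_prefs.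
  rewrite /tree tr /critic count_iota_ord.
  by apply: eq_card => v; rewrite !inE critical_prefs // wE.
have phi_inj : injective phi.
  move=> F F' /(congr1 val)/= /(prefs_inj (fit F) (fit F'))[ww jj].
  have ff : f (start F) = f (start F').
    by rewrite [LHS]surjective_pairing -wE ww jj wE -surjective_pairing.
  have [_ gF _] := fP _ (startP F); have [_ gF' _] := fP _ (startP F').
  by move: gF; rewrite ff gF' => -[/val_inj].
have phi_surj P : exists F, phi F == P.
  have [u [j [fit_j uP]]] := parking_prefs (valP P).
  have st0 : stage 0 (next_larger u, j).
    have D := next_larger_decreasing u.
    by apply/stageP; split=> //; apply: decreasing_forest.
  (* At stage [n] every recorded value is 0, so the preimage under [f] is [start] of an actual
     forest. *)
  have [] := gP _ st0; case gE: (g _) => [p k] /stageP[pF _ _ k0] fE.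
  have startE : start (exist (fun q => is_forest q) p pF) = (p, k).
    by congr pair; apply/ffunP=> v; rewrite ffunE k0.
  exists (exist (fun q => is_forest q) p pF); apply/eqP/val_inj => /=; rewrite -uP startE fE /=.
  by congr prefs; apply: next_larger_inj; rewrite wE startE fE.
pose psi P := xchoose (phi_surj P).
have psiK : cancel psi phi by move=> P; apply/eqP/(xchooseP (phi_surj P)).
by exists psi => // F; apply: phi_inj.
Qed.
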